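(* Let $X \subset \mathbb{C}^3$ be the surface defined by $f(x,y,z) = x^2 - y^2z + z^3$, let $X_m^0$ be the singular fiber of the $m$-th jet scheme $X_m$ with $m \geq 5$, and let $Z_m^0,\ldots,Z_m^3$ be its irreducible components. Then the maximal elements in $\{Z_m^i \cap Z_m^j \mid i \neq j,\ i,j \in \{0,1,2,3\}\}$ with respect to the inclusion relation are $Z_m^0 \cap Z_m^1$, $Z_m^0 \cap Z_m^2$ and $Z_m^0 \cap Z_m^3$, and they are pairwise distinct.
   Context: For $m \geq 0$ let $R_m = \mathbb{C}[x_0,\ldots,x_m,y_0,\ldots,y_m,z_0,\ldots,z_m]$, and define $f^{(0)},\ldots,f^{(m)} \in R_m$ by $f(\sum_{k=0}^m x_kt^k, \sum_{k=0}^m y_kt^k, \sum_{k=0}^m z_kt^k) \equiv \sum_{k=0}^m f^{(k)}t^k \pmod{t^{m+1}}$. The $m$-th jet scheme of $X$ is $X_m = \mathrm{Spec}\,R_m/\langle f^{(0)},\ldots,f^{(m)}\rangle \subseteq \mathbb{A}^{3(m+1)}$, with truncation morphism $\pi_m : X_m \to X$, and $X_m^0 = \pi_m^{-1}(0)$ is the fiber over the origin (a $D_4$-type singular point). Assume $m \geq 5$ and put $L_{322} = \langle x_0,x_1,x_2,y_0,y_1,z_0,z_1\rangle$, $L^1 = \langle x_0,x_1,y_0,z_0,z_1\rangle$, $L^2 = \langle x_0,x_1,y_0,z_0,y_1-z_1\rangle$, $L^3 = \langle x_0,x_1,y_0,z_0,y_1+z_1\rangle$ (ideals of $R_m$), $I_m^0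 = L_{322} + \langle f^{(0)},\ldots,f^{(m)}\rangle$, and $J_m^i = L^i + \langle f^{(0)},\ldots,f^{(m)}\rangle$ for $i = 1,2,3$. Define $Z_m^0 = \mathbf{V}(I_m^0)$ and, for $i = 1,2,3$, $Z_m^i = \overline{\mathbf{V}(J_m^i) \cap \mathbf{D}(y_1)}$, where $\mathbf{D}(y_1)$ is the open subscheme of $X_m$ given by $y_1 \neq 0$ and the bar is Zariski closure in $X_m$. It is known (Mourtada) that for $m \geq 5$ these are irreducible of dimension $2m+1$ and $X_m^0 = Z_m^0 \cup Z_m^1 \cup Z_m^2 \cup Z_m^3$ is the irreducible decomposition. Intersections are taken set-theoretically (as reduced closed subvarieties). *)

(* Defs.v *)
From HB Require Import structures.
From mathcomp Require Import all_boot all_order all_algebra.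
From mathcomp Require Import mathcomp_extra boolp classical_sets reals.
From mathcomp Require Import complex mpoly.

Set Implicit Arguments.
Unset Strict Implicit.
Unset Printing Implicit Defensive.

Import GRing.Theory.
Local Open Scope classical_set_scope.
Local Open Scope ring_scope.

Definition D4 (A : comNzRingType) (x y z : A) : A :=
  x ^+ 2 - y ^+ 2 * z + z ^+ 3.

Definition gen_ideal (A : comNzRingType) (s : seq A) : set A :=
  [set p | exists a : nat -> A, p = \sum_(i < size s) a i * s`_i].

Definition add_ideal (A : comNzRingType) (I J : set A) : set A :=
  [set a + b | a in I & b in J].

Definition maximal_elements (T : Type) (F : set (set T)) : set (set T) :=
  [set S | F S /\ forall S', F S' -> S `<=` S' -> S' = S].

(* Varieties are represented by their sets of complex points, that is, by
   subsets of affine space of dimension 3 (m + 1), whose coordinates are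
   ordered as x_0, ..., x_m, y_0, ..., y_m, z_0, ..., z_m. *)
Section Jets.
Variables (R : realType) (m : nat).

Definition jet_dim : nat := m.+1 + m.+1 + m.+1.
Definition jet_ring := {mpoly R[i][jet_dim]}.
Definition jet_space := 'I_jet_dim -> R[i].

(* inord makes these total in k; the intended range is k <= m. *)
Definition xvar (k : nat) : jet_ring :=
  'X_(lshift m.+1 (lshift m.+1 (inord k : 'I_m.+1))).
Definition yvar (k : nat) : jet_ring :=
  'X_(lshift m.+1 (rshift m.+1 (inord k : 'I_m.+1))).
Definition zvar (k : nat) : jet_ring :=
  'X_(rshift (m.+1 + m.+1) (inord k : 'I_m.+1)).

Definition jet_eq (k : nat) : jet_ring :=
  (D4 (\poly_(j < m.+1) xvar j)
      (\poly_(j < m.+1) yvar j)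
      (\poly_(j < m.+1) zvar j))`_k.

Definition jet_ideal : set jet_ring := gen_ideal (mkseq jet_eq m.+1).

Definition zero_locus (I : set jet_ring) : set jet_space :=
  [set v | forall p, I p -> p.@[v] = 0].

Definition jet_scheme : set jet_space := zero_locus jet_ideal.

Definition jet_closure (S : set jet_space) : set jet_space :=
  [set v | forall P : set jet_ring,
    S `<=` jet_scheme `&` zero_locus P -> (jet_scheme `&` zero_locus P) v].

Definition open_y1 : set jet_space :=
  jet_scheme `&` [set v | (yvar 1).@[v] != 0].

Definition L322 : seq jet_ring :=
  [:: xvar 0; xvar 1; xvar 2; yvar 0; yvar 1; zvar 0; zvar 1].
Definition L1 : seq jet_ring :=
  [:: xvar 0; xvar 1; yvar 0; zvar 0; zvar 1].
Definition L2 : seq jet_ring :=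
  [:: xvar 0; xvar 1; yvar 0; zvar 0; yvar 1 - zvar 1].
Definition L3 : seq jet_ring :=
  [:: xvar 0; xvar 1; yvar 0; zvar 0; yvar 1 + zvar 1].

Definition Z0 : set jet_space :=
  zero_locus (add_ideal (gen_ideal L322) jet_ideal).

Definition Zclosure (L : seq jet_ring) : set jet_space :=
  jet_closure (zero_locus (add_ideal (gen_ideal L) jet_ideal) `&` open_y1).

Definition Z (i : 'I_4) : set jet_space :=
  match val i with
  | 0 => Z0
  | 1 => Zclosure L1
  | 2 => Zclosure L2
  | _ => Zclosure L3
  end.

End Jets.

Arguments Z R m i : clear implicits.

(* Main.v *)
Require Import Defs.
From mathcomp Require Import all_boot all_order all_algebra.
From mathcomp Require Import mathcomp_extra boolp classical_sets reals.
From mathcomp Require Import complex mpoly ring.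

(** The cubic y^2 z - z^3 = z (y - z) (y + z) defines three lines z = k y in the
    (y, z)-plane, one for each root k of k^3 = k, and the components Z_1, Z_2,
    Z_3 correspond to k = 0, 1, -1: Z_i is the closure of the jets of the
    surface with x of order at least 2, z - k y of order at least 2, and y of
    order exactly 1 ([ZE]).  Working with k instead of i treats the three
    components alike.

    Two of these components meet inside Z_0 ([Z_pair_sub]): z_1 = k y_1 and
    z_1 = k' y_1 give y_1 = z_1 = 0, and then f^(4) = 0 reduces to x_2^2 = 0.
    So Z_i meets Z_j inside Z_0 and Z_i, and the maximal intersections are
    among Z_0 and Z_1, Z_0 and Z_2, Z_0 and Z_3.

    All three are maximal, and they are distinct, because the intersection of
    Z_0 and Z_i is not contained in Z_j when i <> j ([crossing_not_sub]).  A
    witness is the jet (0, t^2, k t^2), with k attached to i: it lies in Z_0,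
    and it is the limit as e tends to 0 of the jets (0, e t + t^2, k (e t + t^2))
    of the line z = k y, x = 0, which is contained in the surface
    ([line_jet_closure]).  A polynomial that vanishes on Z_j but not at this jet
    excludes it from Z_j.  It is found by eliminating x_2 from f^(4) and f^(5).
    Put l = z - k y, with k now attached to j, and a = 1 - 3 k^2.  On Z_j these
    equations read x_2^2 = a y_1^2 l_2 and
    2 x_2 x_3 = y_1 (a (2 y_2 l_2 + y_1 l_3) - 3 k l_2^2).
    Squaring the second, substituting the first and cancelling y_1^2 leaves
    4 a l_2 x_3^2 = (a (2 y_2 l_2 + y_1 l_3) - 3 k l_2^2)^2
    ([tangency], [tangency_branch]), which fails at the witness
    ([tangency_line_jet]).  Only f^(4) and f^(5) enter, so m >= 5 suffices. *)

Set Implicit Arguments.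
Unset Strict Implicit.
Unset Printing Implicit Defensive.

Import GRing.Theory Num.Theory.
Local Open Scope classical_set_scope.
Local Open Scope ring_scope.

(** * Maximal pairwise intersections *)

(** An intersection that avoids the index 0 lies below one that involves it, so
    only the latter can be maximal.  Conversely, a set above the intersection of
    [W 0] and [W i] can only come from the indices 0 and i. *)
Lemma maximal_star (T : Type) (n : nat) (W : 'I_n.+1 -> set T) :
  (forall i j, i != 0 -> j != 0 -> i != j -> W i `&` W j `<=` W 0) ->
  (forall i j, i != 0 -> j != 0 -> i != j -> ~ (W 0 `&` W i `<=` W j)) ->
  maximal_elements [set S | exists i j : 'I_n.+1, i != j /\ S = W i `&` W j]
  = [set W 0 `&` W i | i in [set i | i != 0]].
Proof.
move=> sub0 nsub; apply/seteqP; split => S.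
- move=> [[i [j [ij ->]]] maxS].
  have [i0|i0] := eqVneq i 0; first by exists j; rewrite /= -i0 // eq_sym.
  have [j0|j0] := eqVneq j 0; first by exists i; rewrite //= j0 setIC.
  exists i => //; apply: maxS; first by exists 0, i; rewrite eq_sym.
  by move=> v Wv; split; [exact: sub0 Wv | case: Wv].
- move=> [i i0 <-]; split; first by exists 0, i; rewrite eq_sym.
  move=> _ [j [k [jk ->]]] sub.
  have only l : W 0 `&` W i `<=` W l -> l = 0 \/ l = i.
    move=> subl; have [->|l0] := eqVneq l 0; first by left.
    have [->|li] := eqVneq l i; first by right.
    by case: (nsub i l) => //; rewrite eq_sym.
  have [j0|ji] : j = 0 \/ j = i by apply: only => v /sub[].
    all: have [k0|ki] : k = 0 \/ k = i by apply: only => v /sub[].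
  + by rewrite j0 k0 eqxx in jk.
  + by rewrite j0 ki.
  + by rewrite ji k0 setIC.
  + by rewrite ji ki eqxx in jk.
Qed.

(** * Low-order coefficients of the equation *)

Lemma rmorph_D4 (A B : comNzRingType) (h : {rmorphism A -> B}) (x y z : A) :
  h (D4 x y z) = D4 (h x) (h y) (h z).
Proof. by rewrite /D4 rmorphD rmorphB !rmorphXn rmorphM !rmorphXn. Qed.

Section CubicCoefficients.
Variable A : comNzRingType.
Implicit Types p q r : {poly A}.

Lemma D4_coef4 p q r : p`_0 = 0 -> p`_1 = 0 -> q`_0 = 0 -> r`_0 = 0 ->
  (D4 p q r)`_4 = p`_2 ^+ 2 - (q`_1 ^+ 2 * r`_2 + 2 * q`_1 * q`_2 * r`_1)
                  + 3 * r`_1 ^+ 2 * r`_2.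
Proof.
move=> p0 p1 q0 r0; rewrite /D4 !exprS !expr0 !mulr1 coefD coefB.
do !rewrite coefM !big_ord_recl big_ord0 /=.
by rewrite /bump /= !add1n ?subSS ?subn0 ?subnn p0 p1 q0 r0; ring.
Qed.

Lemma D4_coef5 p q r : p`_0 = 0 -> p`_1 = 0 -> q`_0 = 0 -> r`_0 = 0 ->
  (D4 p q r)`_5 = 2 * p`_2 * p`_3
    - (q`_1 ^+ 2 * r`_3 + 2 * q`_1 * q`_2 * r`_2
       + (q`_2 ^+ 2 + 2 * q`_1 * q`_3) * r`_1)
    + 3 * r`_1 * (r`_1 * r`_3 + r`_2 ^+ 2).
Proof.
move=> p0 p1 q0 r0; rewrite /D4 !exprS !expr0 !mulr1 coefD coefB.
do !rewrite coefM !big_ord_recl big_ord0 /=.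
by rewrite /bump /= !add1n ?subSS ?subn0 ?subnn p0 p1 q0 r0; ring.
Qed.

End CubicCoefficients.

(** * Jets as triples of truncated power series *)

Section Jets.
Variables (R : realType) (m : nat).
Local Notation C := R[i].
Local Notation xvar := (xvar R m).
Local Notation yvar := (yvar R m).
Local Notation zvar := (zvar R m).
Local Notation jet_scheme := (@jet_scheme R m).
Implicit Types (v : jet_space R m) (p : jet_ring R m).

Definition jetx v : {poly C} := \poly_(j < m.+1) (xvar j).@[v].
Definition jety v : {poly C} := \poly_(j < m.+1) (yvar j).@[v].
Definition jetz v : {poly C} := \poly_(j < m.+1) (zvar j).@[v].

Lemma meval_jet_eq v k :
  (jet_eq R m k).@[v] = (D4 (jetx v) (jety v) (jetz v))`_k.
Proof.
have mapE (c : nat -> jet_ring R m) :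
    map_poly (meval v) (\poly_(j < m.+1) c j) = \poly_(j < m.+1) (c j).@[v].
  by apply/polyP => j; rewrite coef_map !coef_poly; case: ifP; rewrite ?raddf0.
by rewrite /jet_eq -coef_map rmorph_D4 /= !mapE.
Qed.

Lemma zero_locus_gen (s : seq (jet_ring R m)) v :
  zero_locus (gen_ideal s) v <-> {in s, forall p, p.@[v] = 0}.
Proof.
split=> [sv p ps | sv _ [a ->]].
  apply: sv; exists (fun i => (i == index p s)%:R).
  have ip : (index p s < size s)%N by rewrite index_mem.
  rewrite (bigD1 (Ordinal ip)) //= eqxx mul1r nth_index // big1 ?addr0 //.
  by move=> i /negPf; rewrite -val_eqE /= => ->; rewrite mul0r.
rewrite rmorph_sum big1 // => i _.
by rewrite rmorphM /= (sv s`_i) ?mulr0 ?mem_nth.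
Qed.

(** The locus of a sum of ideals is cut out by the two sets of generators; both
    ideals contain 0, so each is contained in the sum. *)
Lemma zero_locus_add (s s' : seq (jet_ring R m)) :
  zero_locus (add_ideal (gen_ideal s) (gen_ideal s')) =
  zero_locus (gen_ideal s) `&` zero_locus (gen_ideal s').
Proof.
have gen0 t : gen_ideal t (0 : jet_ring R m).
  by exists (fun=> 0); rewrite big1 // => i _; rewrite mul0r.
apply/seteqP; split => [v vI | v [vs vs'] _ [p ps [q qs' <-]]].
  split=> p pI; apply: vI.
  - by exists p => //; exists 0 => //; rewrite addr0.
  - by exists 0 => //; exists p => //; rewrite add0r.
by rewrite rmorphD /= vs // vs' // addr0.
Qed.

Lemma jet_schemeP v :
  jet_scheme v <-> forall k, (k <= m)%N -> (D4 (jetx v) (jety v) (jetz v))`_k = 0.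
Proof.
rewrite [jet_scheme v]zero_locus_gen; split=> [h k km | h p].
  by rewrite -meval_jet_eq; apply: h; apply/mapP; exists k; rewrite ?mem_iota.
by move=> /mapP[k]; rewrite mem_iota /= => km ->; rewrite meval_jet_eq h.
Qed.

Lemma jet_closure_sub (S : set (jet_space R m)) : S `<=` jet_scheme ->
  jet_closure S `<=` jet_scheme.
Proof.
move=> SX v vS; have [] // := vS set0.
by move=> w Sw; split; [exact: SX | move=> p].
Qed.

(** The closure is defined by a test on all closed sets; testing the hypersurface
    of one polynomial is how equations pass from a locus to its closure. *)
Lemma jet_closure_vanish (S : set (jet_space R m)) p : S `<=` jet_scheme ->
  (forall v, S v -> p.@[v] = 0) -> forall v, jet_closure S v -> p.@[v] = 0.
Proof.
move=> SX pS v vS.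
have Sp : S `<=` jet_scheme `&` zero_locus [set p].
  by move=> w Sw; split; [exact: SX | move=> _ ->; exact: pS].
exact: (vS _ Sp).2.
Qed.

Lemma punctured_line_poly0 (q : {poly C}) :
  (forall e, e != 0 -> q.[e] = 0) -> q.[0] = 0.
Proof.
move=> q0; have [->|qn0] := eqVneq q 0; first by rewrite horner0.
pose rs : seq C := [seq k.+1%:R | k <- iota 0 (size q)].
suff : (size rs < size q)%N by rewrite size_map size_iota ltnn.
apply: max_poly_roots => //.
  by apply/allP => _ /mapP[k _ ->]; apply/rootP/q0; rewrite pnatr_eq0.
by rewrite map_inj_uniq ?iota_uniq // => k l /eqP; rewrite eqr_nat => /eqP[].
Qed.

(** Limits along a polynomial arc stay in the Zariski closure: a polynomial that
    vanishes on [S] becomes, along the arc, a polynomial in the parameter with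
    infinitely many zeros. *)
Lemma jet_closure_arc (S : set (jet_space R m)) (c : C -> jet_space R m) :
  (forall i, exists q : {poly C}, forall e, c e i = q.[e]) ->
  jet_scheme (c 0) -> (forall e, e != 0 -> S (c e)) -> jet_closure S (c 0).
Proof.
move=> /boolp.choice[q cq] Xc Sc P SP; split=> // p Pp.
have cE e : (mmap (@polyC C) q p).[e] = p.@[c e].
  rewrite mevalE /mmap horner_sum; apply: eq_bigr => t _.
  rewrite hornerM hornerC; congr (_ * _).
  by rewrite /mmap1 horner_prod; apply: eq_bigr => i _; rewrite horner_exp cq.
rewrite -cE; apply: punctured_line_poly0 => e e0.
by rewrite cE; apply: (SP _ (Sc e e0)).2.
Qed.

(** * The three components attached to lines *)

Definition branch (k : C) : set (jet_space R m) :=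
  [set v | [/\ jet_scheme v,
    [/\ (xvar 0).@[v] = 0, (xvar 1).@[v] = 0, (yvar 0).@[v] = 0
      & (zvar 0).@[v] = 0],
    (zvar 1).@[v] = k * (yvar 1).@[v]
    & (yvar 1).@[v] != 0]].

Lemma branchE (k : C) l :
  (forall v, l.@[v] = 0 <-> (zvar 1).@[v] = k * (yvar 1).@[v]) ->
  zero_locus (add_ideal (gen_ideal [:: xvar 0; xvar 1; yvar 0; zvar 0; l])
                        (@jet_ideal R m)) `&` @open_y1 R m
  = branch k.
Proof.
move=> lE; rewrite zero_locus_add; apply/seteqP.
split=> [v [[/zero_locus_gen gv Xv] [_ y1]] | v [Xv [x0 x1 y0 z0] /lE l0 y1]].
  by split=> //; [split|apply/lE]; apply: gv; rewrite !inE eqxx ?orbT.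
split=> //; split=> //; apply/zero_locus_gen => p; rewrite !inE.
by do 4?case/predU1P => [-> //|]; move=> /eqP ->.
Qed.

Lemma branch_scheme k : branch k `<=` jet_scheme.
Proof. by move=> v []. Qed.

(** Meaningful for nonzero indices only: the line z = k y, with k the slope, is
    the factor z, y - z or y + z that defines the component Z_1, Z_2 or Z_3. *)
Definition slope (i : 'I_4) : C :=
  match val i with 2 => 1 | 3 => -1 | _ => 0 end.

Lemma ZE i : i != 0 -> Z R m i = jet_closure (branch (slope i)).
Proof.
case: i => -[|[|[|[|//]]]] //= hi _; rewrite /Z /slope /= /Zclosure.
- by rewrite (@branchE 0) // => v; rewrite mul0r.
- rewrite (@branchE 1) // => v; rewrite mul1r rmorphB /=.
  by split=> [/eqP|->]; rewrite ?subrr // subr_eq0 => /eqP.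
- rewrite (@branchE (-1)) // => v; rewrite mulN1r rmorphD /= addrC.
  by split=> [/eqP|->]; rewrite ?addNr // addr_eq0 => /eqP.
Qed.

(** * An equation that separates the components *)

(** The result of eliminating x_2 between f^(4) and f^(5) in the coordinates y and
    l = z - k y, in which the surface is
    x^2 = (1 - 3 k^2) y^2 l - 3 k y l^2 - l^3 when k^3 = k. *)
Definition tangency (k : C) : jet_ring R m :=
  let a := 1 - 3 * k ^+ 2 in
  let l j := zvar j - k *: yvar j in
  (4 * a) *: (l 2%N * xvar 3 ^+ 2)
  - (a *: (2 *: (yvar 2 * l 2%N) + yvar 1 * l 3%N) - (3 * k) *: l 2%N ^+ 2) ^+ 2.

Lemma meval_tangency (k : C) v :
  let a := 1 - 3 * k ^+ 2 in
  let l j := (zvar j).@[v] - k * (yvar j).@[v] in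
  (tangency k).@[v] = 4 * a * (l 2%N * (xvar 3).@[v] ^+ 2)
  - (a * (2 * ((yvar 2).@[v] * l 2%N) + (yvar 1).@[v] * l 3%N)
     - 3 * k * l 2%N ^+ 2) ^+ 2.
Proof.
rewrite /tangency /=.
by do ?rewrite !(mevalZ, rmorphB, rmorphXn, rmorphD, rmorphM) /=.
Qed.

(** * Jets of the lines x = 0, z = k y *)

(** The coefficients of e t + t^2. *)
Definition line_coord (e : C) (j : nat) : C :=
  (j == 2)%N%:R + e * (j == 1)%N%:R.

Definition jet_point (a b c : nat -> C) : jet_space R m := fun i =>
  match split i with
  | inl j => match split j with inl h => a h | inr h => b h end
  | inr h => c h
  end.

Definition line_jet (k e : C) : jet_space R m :=
  jet_point (fun=> 0) (line_coord e) (fun j => k * line_coord e j).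

Lemma meval_line_jet (k e : C) j : (j <= m)%N ->
  [/\ (xvar j).@[line_jet k e] = 0, (yvar j).@[line_jet k e] = line_coord e j
    & (zvar j).@[line_jet k e] = k * line_coord e j].
Proof.
move=> jm; rewrite !mevalXU /line_jet /jet_point.
by rewrite !(unsplitK (inl _)) !(unsplitK (inr _)) !inordK.
Qed.

(** The line is contained in the surface because k^3 = k. *)
Lemma line_jet_scheme (k e : C) : k ^+ 3 = k -> jet_scheme (line_jet k e).
Proof.
move=> k3; apply/jet_schemeP => j jm.
have -> : jetx (line_jet k e) = 0.
  apply/polyP => h; rewrite coef_poly coef0; case: ifP => // hm.
  by have [] := meval_line_jet k e hm.
have -> : jetz (line_jet k e) = k *: jety (line_jet k e).
  apply/polyP => h; rewrite coefZ !coef_poly; case: ifP => [hm|]; last by rewrite mulr0.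
  by have [_ -> ->] := meval_line_jet k e hm.
rewrite /D4 expr0n add0r exprZn k3 -scalerAr -exprSr addNr.
by rewrite coef0.
Qed.

(** * Comparing the components *)

Section Order5.
Hypothesis m5 : (5 <= m)%N.

Lemma coef_jet v j : (j <= 5)%N ->
  [/\ (jetx v)`_j = (xvar j).@[v], (jety v)`_j = (yvar j).@[v]
    & (jetz v)`_j = (zvar j).@[v]].
Proof. by move=> j5; rewrite !coef_poly ltnS (leq_trans j5 m5). Qed.

Lemma jet_coef4 v : jet_scheme v -> (xvar 0).@[v] = 0 -> (xvar 1).@[v] = 0 ->
  (yvar 0).@[v] = 0 -> (zvar 0).@[v] = 0 ->
  (xvar 2).@[v] ^+ 2
  - ((yvar 1).@[v] ^+ 2 * (zvar 2).@[v]
     + 2 * (yvar 1).@[v] * (yvar 2).@[v] * (zvar 1).@[v])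
  + 3 * (zvar 1).@[v] ^+ 2 * (zvar 2).@[v] = 0.
Proof.
move=> /jet_schemeP/(_ 4 (ltnW m5)) Xv x0 x1 y0 z0; move: Xv.
have [[X0 Y0 Z0] [X1 Y1 Z1] [X2 Y2 Z2]] :=
  And3 (@coef_jet v 0 isT) (@coef_jet v 1 isT) (@coef_jet v 2 isT).
by rewrite D4_coef4 ?X0 ?X1 ?Y0 ?Z0 // X2 Y1 Y2 Z1 Z2.
Qed.

Lemma jet_coef5 v : jet_scheme v -> (xvar 0).@[v] = 0 -> (xvar 1).@[v] = 0 ->
  (yvar 0).@[v] = 0 -> (zvar 0).@[v] = 0 ->
  2 * (xvar 2).@[v] * (xvar 3).@[v]
  - ((yvar 1).@[v] ^+ 2 * (zvar 3).@[v]
     + 2 * (yvar 1).@[v] * (yvar 2).@[v] * (zvar 2).@[v]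
     + ((yvar 2).@[v] ^+ 2 + 2 * (yvar 1).@[v] * (yvar 3).@[v]) * (zvar 1).@[v])
  + 3 * (zvar 1).@[v] * ((zvar 1).@[v] * (zvar 3).@[v] + (zvar 2).@[v] ^+ 2) = 0.
Proof.
move=> /jet_schemeP/(_ 5 m5) Xv x0 x1 y0 z0; move: Xv.
have [[X0 Y0 Z0] [X1 Y1 Z1] [X2 Y2 Z2]] :=
  And3 (@coef_jet v 0 isT) (@coef_jet v 1 isT) (@coef_jet v 2 isT).
have [X3 Y3 Z3] := @coef_jet v 3 isT.
by rewrite D4_coef5 ?X0 ?X1 ?Y0 ?Z0 // X2 X3 Y1 Y2 Y3 Z1 Z2 Z3.
Qed.

(** Nonvanishing of y_1 is what allows the elimination: the combination of f^(4)
    and f^(5) that removes x_2 is y_1^2 times [tangency].  The conclusion then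
    extends to the closure, where y_1 may vanish. *)
Lemma tangency_branch (k : C) v : k ^+ 3 = k -> branch k v ->
  (tangency k).@[v] = 0.
Proof.
move=> k3 [Xv [x0 x1 y0 z0] z1 y1]; rewrite meval_tangency.
have := jet_coef4 Xv x0 x1 y0 z0; have := jet_coef5 Xv x0 x1 y0 z0.
rewrite z1; move: y1.
move: (xvar 2).@[v] (xvar 3).@[v] (yvar 1).@[v] (yvar 2).@[v] (yvar 3).@[v].
move: (zvar 2).@[v] (zvar 3).@[v] => {v Xv x0 x1 y0 z0 z1}.
move=> z2 z3 x2 x3 y1 y2 y3 y1n0 f5 f4 /=.
set a := 1 - 3 * k ^+ 2; set l2 := z2 - k * y2; set l3 := z3 - k * y3.
have e4 : x2 ^+ 2 = a * y1 ^+ 2 * l2.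
  apply/eqP; rewrite -subr_eq0; apply/eqP; rewrite -[RHS]f4 /a /l2.
  by ring: k3.
have e5 : 2 * x2 * x3 = y1 * (a * (2 * (y2 * l2) + y1 * l3) - 3 * k * l2 ^+ 2).
  apply/eqP; rewrite -subr_eq0; apply/eqP; rewrite -[RHS]f5 /a /l2 /l3.
  by ring: k3.
apply/eqP; rewrite -(inj_eq (mulfI (expf_neq0 2 y1n0))) mulr0 mulrBr subr_eq0.
rewrite -[X in _ == X]exprMn -e5; apply/eqP.
by ring: e4.
Qed.

Lemma line_jet_Z0 (k : C) : k ^+ 3 = k -> Z0 (line_jet k 0).
Proof.
move=> k3; rewrite /Z0 zero_locus_add; split; last exact: line_jet_scheme.
have c j : (j <= 5)%N -> j != 2 ->
    [/\ (xvar j).@[line_jet k 0] = 0, (yvar j).@[line_jet k 0] = 0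
      & (zvar j).@[line_jet k 0] = 0].
  move=> j5 /negPf j2; have [-> -> ->] := meval_line_jet k 0 (leq_trans j5 m5).
  by rewrite /line_coord j2 mul0r addr0 mulr0.
have [x2 _ _] := meval_line_jet k 0 (leq_trans (isT : 2 <= 5) m5)%N.
have [[x0 y0 z0] [x1 y1 z1]] := conj (c 0 isT isT) (c 1 isT isT).
apply/zero_locus_gen => p; rewrite !inE.
by do 6?case/predU1P => [-> //|]; move=> /eqP ->.
Qed.

(** For e <> 0 the jet of the line has y_1 = e <> 0, hence lies on the branch
    itself; the arc in e reaches y_1 = 0 in the limit. *)
Lemma line_jet_closure (k : C) : k ^+ 3 = k -> jet_closure (branch k) (line_jet k 0).
Proof.
move=> k3; apply: jet_closure_arc; last first.
- move=> e e0; split; first exact: line_jet_scheme.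
  + have [x0 y0 z0] := meval_line_jet k e (leq0n m).
    have [x1 _ _] := meval_line_jet k e (leq_trans (isT : 1 <= 5) m5)%N.
    by rewrite x0 x1 y0 z0 /line_coord mulr0 addr0 mulr0.
  + by have [_ -> ->] := meval_line_jet k e (leq_trans (isT : 1 <= 5) m5)%N.
  + have [_ -> _] := meval_line_jet k e (leq_trans (isT : 1 <= 5) m5)%N.
    by rewrite /line_coord add0r mulr1.
- exact: line_jet_scheme.
have coordP j : exists q : {poly C}, forall e, line_coord e j = q.[e].
  exists ((j == 2)%N%:R%:P + 'X * (j == 1)%N%:R%:P) => e.
  by rewrite !hornerE.
rewrite /line_jet /jet_point => i.
case: split => [j|j]; first case: split => j'.
- by exists 0 => e; rewrite horner0.
- exact: coordP.
- by have [q qE] := coordP j; exists (k *: q) => e; rewrite hornerZ qE.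
Qed.

(** The value is - ((k' - k) (1 - 3 k'^2))^2.  The first factor is nonzero because
    the lines differ, the second because k' is a simple root of k - k^3. *)
Lemma tangency_line_jet (k k' : C) : k ^+ 3 = k -> k' ^+ 3 = k' -> k' != k ->
  (tangency k).@[line_jet k' 0] != 0.
Proof.
move=> k3 k'3 kk'.
have [_ y1 _] := meval_line_jet k' 0 (leq_trans (isT : 1 <= 5) m5)%N.
have [_ y2 z2] := meval_line_jet k' 0 (leq_trans (isT : 2 <= 5) m5)%N.
have [x3 y3 z3] := meval_line_jet k' 0 (leq_trans (isT : 3 <= 5) m5)%N.
(* Divide k'^3 - k^3 = k' - k by k' - k. *)
have kk'E : k * k' = 1 - k ^+ 2 - k' ^+ 2.
  apply: (mulfI (_ : k' - k != 0)); first by rewrite subr_eq0.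
  by ring: k3 k'3.
have simple : 1 - 3 * k' ^+ 2 != 0.
  (* k'^2 is idempotent, which makes this product constant. *)
  have : (1 - 3 * k' ^+ 2) * (2 - 3 * k' ^+ 2) = 2.
    by ring: k'3.
  by apply: contra_eq_neq => ->; rewrite mul0r eq_sym pnatr_eq0.
rewrite meval_tangency y1 y2 z2 x3 y3 z3 /line_coord /=.
rewrite [X in X != _](_ : _ = - ((k' - k) * (2 - 3 * k ^+ 2 - 3 * (k * k'))) ^+ 2).
  rewrite [X in (k' - k) * X](_ : _ = - (1 - 3 * k' ^+ 2)); last by ring: kk'E.
  by rewrite oppr_eq0 expf_neq0 // mulf_neq0 ?oppr_eq0 // subr_eq0.
by ring.
Qed.

Lemma slope3 (i : 'I_4) : slope i ^+ 3 = slope i :> C.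
Proof.
by case: i => -[|[|[|[|//]]]] hi; rewrite /slope /= ?expr0n ?expr1n // -signr_odd.
Qed.

Lemma slope_inj (i j : 'I_4) : i != 0 -> j != 0 -> i != j ->
  slope i != slope j.
Proof.
have n1 : (-1 : C) != 1 by rewrite eqNr oner_neq0.
move: i j => [[|[|[|[|//]]]] hi] [[|[|[|[|//]]]] hj] // _ _ _.
all: rewrite /slope /= ?oppr_eq0 ?(eq_sym 0) ?oppr_eq0 ?oner_neq0 //.
by rewrite eq_sym.
Qed.

Lemma crossing_not_sub (i j : 'I_4) : i != 0 -> j != 0 -> i != j ->
  ~ (Z R m 0 `&` Z R m i `<=` Z R m j).
Proof.
move=> i0 j0 ij /(_ (line_jet (slope i) 0)) sub.
have /eqP := tangency_line_jet (slope3 j) (slope3 i) (slope_inj i0 j0 ij); apply.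
apply: (jet_closure_vanish (@branch_scheme (slope j))).
  by move=> v; apply: tangency_branch; exact: slope3.
rewrite -ZE //; apply: sub; split; first exact: line_jet_Z0 (slope3 i).
by rewrite ZE //; exact: line_jet_closure (slope3 i).
Qed.

Lemma Z_vanish (i : 'I_4) v : i != 0 -> Z R m i v ->
  [/\ jet_scheme v,
    [/\ (xvar 0).@[v] = 0, (xvar 1).@[v] = 0, (yvar 0).@[v] = 0
      & (zvar 0).@[v] = 0]
    & (zvar 1).@[v] = slope i * (yvar 1).@[v]].
Proof.
move=> i0; rewrite ZE // => vi; have BX := @branch_scheme (slope i).
have van p : (forall w, branch (slope i) w -> p.@[w] = 0) -> p.@[v] = 0.
  by move=> pB; exact: jet_closure_vanish BX pB v vi.
split; first exact: jet_closure_sub vi.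
  by split; apply: van => w [_ []].
apply/eqP; rewrite -subr_eq0 -mevalZ -rmorphB; apply/eqP/van.
by move=> w [_ _ z1 _]; rewrite rmorphB /= mevalZ z1 subrr.
Qed.

Lemma Z_pair_sub (i j : 'I_4) : i != 0 -> j != 0 -> i != j ->
  Z R m i `&` Z R m j `<=` Z R m 0.
Proof.
move=> i0 j0 ij v [/(Z_vanish i0)[Xv [x0 x1 y0 z0] zi] /(Z_vanish j0)[_ _ zj]].
have y1 : (yvar 1).@[v] = 0.
  apply/eqP; have /eqP := zi; rewrite zj -subr_eq0 -mulrBl mulf_eq0 subr_eq0.
  by rewrite eq_sym (negPf (slope_inj i0 j0 ij)).
have z1 : (zvar 1).@[v] = 0 by rewrite zi y1 mulr0.
have x2 : (xvar 2).@[v] = 0.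
  have := jet_coef4 Xv x0 x1 y0 z0; rewrite y1 z1 !expr0n /= !(mulr0, mul0r).
  by rewrite !addr0 subr0 => /eqP; rewrite sqrf_eq0 => /eqP.
rewrite /Z /= /Z0 zero_locus_add; split=> //; apply/zero_locus_gen => p.
by rewrite !inE; do 6?case/predU1P => [-> //|]; move=> /eqP ->.
Qed.

End Order5.

End Jets.

Theorem theorem3p17 (R : realType) (m : nat) (hm : (5 <= m)%N) :
  [/\ maximal_elements
        [set S | exists i j : 'I_4, i != j /\ S = Z R m i `&` Z R m j]
      = [set Z R m 0 `&` Z R m 1;
             Z R m 0 `&` Z R m 2;
             Z R m 0 `&` Z R m 3],
      Z R m 0 `&` Z R m 1 <> Z R m 0 `&` Z R m 2,
      Z R m 0 `&` Z R m 1 <> Z R m 0 `&` Z R m 3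
    & Z R m 0 `&` Z R m 2 <> Z R m 0 `&` Z R m 3].
Proof.
have distinct i j : i != 0 -> j != 0 -> i != j ->
    Z R m 0 `&` Z R m i <> Z R m 0 `&` Z R m j.
  move=> i0 j0 ij eqZ; apply: (crossing_not_sub hm i0 j0 ij) => v Zv.
  by have [] : (Z R m 0 `&` Z R m j) v by rewrite -eqZ.
split; try exact: distinct.
rewrite (maximal_star (Z_pair_sub hm) (crossing_not_sub hm)).
apply/seteqP; split => [S [i i0 <-] | S].
  have : i \in [:: 1; 2; 3 : 'I_4] by case: i i0 => -[|[|[|[|]]]].
  by rewrite !inE => /or3P[] /eqP ->; [left; left | left; right | right].
by move=> [[->|->]|->]; [exists 1 | exists 2 | exists 3].
Qed.
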